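(* Let $n$ be an even positive integer, and in $\mathbb{Z}_{4n+1}$ let $S=\{\pm 2n,\pm(2n-1)\}$ and $R=\{\pm(2+4k)\mid k=0,\ldots,\frac{n}{2}-1\}$. Then the complete graph $K_{4n+1}$ can be expressed as the graphical matrix product of the Cayley graphs $G=\mathrm{Cay}(\mathbb{Z}_{4n+1};S)$ and $H=\mathrm{Cay}(\mathbb{Z}_{4n+1};R)$; that is, there are labelings $g$ of $G$ and $h$ of $H$ such that, with respect to these labelings, $A(G)A(H)=A(K_{4n+1})$.
   Context: For a subset $S=-S$ of $\mathbb{Z}_N$ not containing $0$, $\mathrm{Cay}(\mathbb{Z}_N;S)$ is the simple graph with vertex set $\mathbb{Z}_N$ in which $x$ and $y$ are adjacent if and only if $x-y\in S$. A labeling of a graph on $N$ vertices is a bijection from its vertex set to an $N$-element index set such as $\{0,1,\ldots,N-1\}$ (the same index set for both graphs); it determines the $N\times N$ adjacency matrix $A(\cdot)$ of the graph. $A(K_N)=J_N-I_N$, where $J_N$ is the all-ones matrix. *)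

(* Defs.v *)
From mathcomp Require Import all_boot all_order all_algebra.
From mathcomp Require Import zify.
Set Implicit Arguments. Unset Strict Implicit. Unset Printing Implicit Defensive.
Import GRing.Theory.
Local Open Scope ring_scope.

(* The adjacency relation of Cay(V; S); it is a simple graph when S = -S and
   0 \notin S, see [cayley_sym] and [cayley_irr]. *)
Definition cayley (V : finZmodType) (S : {set V}) : rel V :=
  fun x y => x - y \in S.

Lemma cayley_sym (V : finZmodType) (S : {set V}) :
  (forall x, (- x \in S) = (x \in S)) -> symmetric (cayley S).
Proof. by move=> SN x y; rewrite /cayley -SN opprB. Qed.

Lemma cayley_irr (V : finZmodType) (S : {set V}) :
  0 \notin S -> irreflexive (cayley S).
Proof. by move=> S0 x; rewrite /cayley subrr; apply: negbTE. Qed.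

(* The entry (i, j) is 1 iff the vertices labeled i and j are adjacent;
   meant for bijective g. *)
Definition adjmx (T : finType) (N : nat) (e : rel T) (g : T -> 'I_N) : 'M[int]_N :=
  \matrix_(i, j) [exists x, exists y, [&& g x == i, g y == j & e x y]]%:R.

(* For 0 < n, 'Z_(4 * n + 1) is the ring of integers modulo 4n + 1; it degenerates
   to Z/2 for n = 0, which the statement excludes. *)
Definition setS (n : nat) : {set 'Z_(4 * n + 1)} :=
  [set (2 * n)%N%:R; - (2 * n)%N%:R; (2 * n - 1)%N%:R; - (2 * n - 1)%N%:R].

Definition setR (n : nat) : {set 'Z_(4 * n + 1)} :=
  [set (2 + 4 * k)%N%:R | k : 'I_n./2] :|:
  [set - (2 + 4 * k)%N%:R | k : 'I_n./2].

Lemma natZ_neq0 (n m : nat) :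
  (0 < n)%N -> (0 < m < 4 * n + 1)%N -> (m%:R : 'Z_(4 * n + 1)) != 0.
Proof.
move=> n0 mb; apply/eqP => /(congr1 val) /=.
by rewrite val_Zp_nat ?modn_small; lia.
Qed.

Lemma setS_opp (n : nat) x : (- x \in setS n) = (x \in setS n).
Proof.
rewrite !inE !eqr_opp -!(eqr_oppLR x).
by do !case: (_ == _).
Qed.

Lemma setS_0 (n : nat) : (0 < n)%N -> 0 \notin setS n.
Proof.
move=> n0; rewrite !inE ![0 == _]eq_sym !oppr_eq0.
by rewrite !(negbTE (natZ_neq0 n0 _)) //; lia.
Qed.

Lemma setR_opp (n : nat) x : (- x \in setR n) = (x \in setR n).
Proof.
rewrite !inE orbC; congr (_ || _); apply/imsetP/imsetP => -[k _].
- by move/oppr_inj->; exists k.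
- by move->; exists k.
- by move=> xE; exists k => //; rewrite -xE opprK.
- by move->; exists k; rewrite ?opprK.
Qed.

Lemma setR_0 (n : nat) : (0 < n)%N -> 0 \notin setR n.
Proof.
move=> n0; rewrite inE negb_or; apply/andP.
by split; apply/imsetP => -[k _] /eqP; rewrite eq_sym ?oppr_eq0;
  apply/negP/natZ_neq0 => //; have := ltn_ord k; lia.
Qed.

(* Main.v *)
Require Import Defs.
From mathcomp Require Import all_boot all_order all_algebra.
From mathcomp Require Import zify.
Import GRing.Theory.
Local Open Scope ring_scope.

(** Label both graphs by the same bijection.  The entry of A(G) A(H) at the
    labels of x and z counts the vertices y with x - y in S and y - z in R, that
    is, the ways to write x - z as s + r with s in S and r in R.  So the theorem
    says that s + r takes every nonzero value exactly once and never vanishes.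

    Multiplication by 2 is invertible modulo 4n + 1 and turns S into {1, 3, -1, -3}
    and R into the elements +-(4 + 8k) with 0 <= k < n/2.  The sums of 4 + 8k and
    an element of {1, 3, -1, -3} are the odd numbers from 1 to 4n - 1, and their
    opposites are the even numbers from 2 to 4n: every nonzero residue is a sum
    ([setS_setR_cover]).  As S and R have at most 4 and n elements, there are at
    most 4n sums for 4n nonzero residues, so no value is repeated and 0 is not
    reached ([count_factorization]). *)

(** The map (s, r) |-> s + r has fewer than #|V| arguments and reaches the
    #|V| - 1 nonzero elements, so it is a bijection from S x R onto them. *)
Lemma count_factorization (V : finZmodType) (S R : {set V}) (x z : V) :
    (forall d, d != 0 -> exists s r, [/\ s \in S, r \in R & d = s + r]) ->
    (#|S| * #|R| < #|V|)%N ->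
  #|[set y | (x - y \in S) && (y - z \in R)]| = (x != z).
Proof.
move=> cover small; pose sum2 (p : V * V) := p.1 + p.2.
have sub : [set~ 0] \subset sum2 @: setX S R.
  apply/subsetP => d; rewrite in_setC1 => /cover [s [r [sS rR ->]]].
  by apply/imsetP; exists (s, r); rewrite // in_setX sS.
have SR_le : (#|setX S R| <= #|[set~ 0%R : V]|)%N.
  by rewrite cardsX cardsC1 -ltnS (ltn_predK small).
have im_le := leq_imset_card sum2 (setX S R).
have imE : [set~ 0] = sum2 @: setX S R.
  by apply/eqP; rewrite eqEcard sub (leq_trans im_le).
have inj : {in setX S R &, injective sum2}.
  by apply/imset_injP; rewrite eqn_leq im_le -imE.
have [-> | xz] := eqVneq x z.
  apply/eqP; rewrite cards_eq0; apply/set0Pn => -[y].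
  rewrite inE => /andP[yS yR].
  have : sum2 (z - y, y - z) \in sum2 @: setX S R.
    by apply: imset_f; rewrite in_setX yS.
  by rewrite -imE in_setC1 /sum2 /= addrA subrK subrr eqxx.
have [s [r [sS rR xzE]]] : exists s r, [/\ s \in S, r \in R & x - z = s + r].
  by apply: cover; rewrite subr_eq0.
apply/eqP/cards1P; exists (r + z); apply/setP => y; rewrite !inE.
apply/andP/eqP => [[yS yR] | ->].
  have [] : (x - y, y - z) = (s, r).
    by apply: inj; rewrite ?in_setX ?yS ?sS // /sum2 /= addrA subrK.
  by move=> _ <-; rewrite subrK.
by rewrite opprD addrCA xzE addrC !addrK.
Qed.

Lemma card_setS_le (n : nat) : (#|setS n| <= 4)%N.
Proof.
apply: leq_trans (leq_card_setU _ _) _; rewrite cards1 addn1 ltnS.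
apply: leq_trans (leq_card_setU _ _) _; rewrite cards1 addn1 ltnS.
by rewrite cards2; case: (_ != _).
Qed.

Lemma card_setR_le (n : nat) : (#|setR n| <= n)%N.
Proof.
apply: leq_trans (leq_card_setU _ _) _.
apply: leq_trans (leq_add (leq_imset_card _ _) (leq_imset_card _ _)) _.
by rewrite card_ord; lia.
Qed.

Lemma mem_setR_opp (n k : nat) :
  (k < n./2)%N -> - (2 + 4 * k)%N%:R \in setR n.
Proof.
move=> kn; rewrite inE; apply/orP; right.
by apply/imsetP; exists (Ordinal kn).
Qed.

(** Up to a sign the nonzero residue is 2n - j with 0 <= j < 2n.  Writing
    j = 4k + i with i < 4, the number -(2 + 4k) serves as r, and i selects the
    element of S. *)
Lemma setS_setR_cover (n : nat) (d : 'Z_(4 * n + 1)) :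
    (0 < n)%N -> ~~ odd n -> d != 0 ->
  exists s r, [/\ s \in setS n, r \in setR n & d = s + r].
Proof.
move=> n_gt0 n_even d0.
have N0 : (4 * n + 1)%N%:R = 0 :> 'Z_(4 * n + 1) by apply: pchar_Zp; lia.
have d_lt : (d < 4 * n + 1)%N.
  by have := ltn_ord d; rewrite /Zp_trunc /=; lia.
have d_gt0 : (0 < d)%N.
  by rewrite lt0n; apply: contra d0 => /eqP dv0; apply/eqP/val_inj.
have half (m : nat) : (0 < m <= 2 * n)%N ->
    exists s r, [/\ s \in setS n, r \in setR n & m%:R = s + r].
  move=> mb; have [j jE] : exists j, j = (2 * n - m)%N by exists (2 * n - m)%N.
  have jdiv := divn_eq j 4; have jmod : (j %% 4 < 4)%N by rewrite ltn_mod.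
  have kn : (j %/ 4 < n./2)%N by lia.
  move: (j %/ 4)%N (j %% 4)%N kn jdiv jmod => k i kn jdiv jmod.
  have rR := @mem_setR_opp n k kn.
  have wrap (a b : nat) :
      (m + a + b = 4 * n + 1)%N -> m%:R = - a%:R - b%:R :> 'Z_(4 * n + 1).
    move=> mab; apply/eqP; rewrite -opprD -addr_eq0 addrA -!natrD.
    by rewrite mab N0.
  have diff (a b : nat) : (m + b = a)%N -> m%:R = a%:R - b%:R :> 'Z_(4 * n + 1).
    by move=> <-; rewrite natrD addrK.
  case: i jdiv jmod => [|[|[|[|//]]]] jdiv _.
  - exists (- (2 * n - 1)%N%:R), (- (2 + 4 * k)%N%:R).
    by split; [rewrite !inE eqxx !orbT | | apply: wrap; lia].
  - exists (- (2 * n)%N%:R), (- (2 + 4 * k)%N%:R).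
    by split; [rewrite !inE eqxx !orbT | | apply: wrap; lia].
  - exists (2 * n)%N%:R, (- (2 + 4 * k)%N%:R).
    by split; [rewrite !inE eqxx | | apply: diff; lia].
  - exists (2 * n - 1)%N%:R, (- (2 + 4 * k)%N%:R).
    by split; [rewrite !inE eqxx !orbT | | apply: diff; lia].
have [d_le | d_gt] := leqP d (2 * n).
  by rewrite -[d]natr_Zp; apply: half; rewrite d_gt0.
have [|s [r [sS rR sr]]] := half (4 * n + 1 - d)%N; first by lia.
exists (- s), (- r); rewrite setS_opp setR_opp; split=> //.
by rewrite -opprD -sr natrB ?(ltnW d_lt) // N0 sub0r opprK natr_Zp.
Qed.

Lemma adjmxE (T : finType) (N : nat) (e : rel T) (g : T -> 'I_N) x y :
  injective g -> adjmx e g (g x) (g y) = (e x y)%:R.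
Proof.
move=> g_inj; rewrite mxE; congr (_%:R); congr nat_of_bool.
apply/existsP/idP => [[x' /existsP[y']] | exy].
  by rewrite !(inj_eq g_inj) => /and3P[/eqP-> /eqP->].
by exists x; apply/existsP; exists y; rewrite !eqxx.
Qed.

Lemma adjmx_mul_count (T : finType) (N : nat) (e f : rel T) (g : T -> 'I_N) x z :
    bijective g ->
  (adjmx e g *m adjmx f g) (g x) (g z) = #|[set y | e x y && f y z]|%:R.
Proof.
move=> g_bij; have g_inj := bij_inj g_bij.
rewrite mxE (reindex g) /=; last exact: onW_bij.
rewrite -sum1_card natr_sum [RHS]big_mkcond /=; apply: eq_bigr => y _.
by rewrite !adjmxE // inE; case: (e x y); case: (f y z).
Qed.

Theorem theorem3p20 (n : nat) (n_gt0 : (0 < n)%N) (n_even : ~~ odd n) :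
  exists (g h : 'Z_(4 * n + 1) -> 'I_(4 * n + 1)),
    [/\ bijective g, bijective h &
        adjmx (cayley (setS n)) g *m adjmx (cayley (setR n)) h
        = const_mx 1 - 1%:M].
Proof.
have NE : (Zp_trunc (4 * n + 1)).+2 = (4 * n + 1)%N by apply: Zp_cast; lia.
pose g : 'Z_(4 * n + 1) -> 'I_(4 * n + 1) := cast_ord NE.
have g_bij : bijective g.
  by exists (cast_ord (esym NE)); [apply: cast_ordK | apply: cast_ordKV].
exists g, g; split=> //; apply/matrixP => i j.
have [g' _ g'K] := g_bij; rewrite -[i]g'K -[j]g'K.
rewrite adjmx_mul_count // !mxE (inj_eq (bij_inj g_bij)) /cayley.
rewrite count_factorization; first by case: eqVneq; rewrite ?subrr ?subr0.
  by move=> d; apply: setS_setR_cover.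
rewrite card_ord [X in (_ < X)%N]NE.
apply: leq_ltn_trans (leq_mul (card_setS_le n) (card_setR_le n)) _.
by rewrite addn1.
Qed.
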